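(* There is a polynomial $f(k,p)$ in two variables, of degree at most $4$, with the following property. For every pair of integers $k \ge 2$, $p \ge 1$ there exists a finite family $\mathcal{F}(k,p)$ of (forbidden) finite graphs such that any graph $G$ with minimum edge-degree at least $f(k,p)$ is a member of $L_k^{(p)}$ if and only if $G$ has no induced subgraph isomorphic to a member of $\mathcal{F}(k,p)$.
   Context: Graphs are finite and simple. A hypergraph $H=(X,E)$ consists of a finite vertex set $X$ and a finite family $E$ of non-empty subsets of $X$ (the edges; repeated edges are allowed and are then counted as distinct members of the family). $H$ is $k$-uniform ($k\ge 2$) if every edge has exactly $k$ elements. For $\{x,y\}\subset X$ with $x\ne y$, $d_H(\{x,y\})$ is the number of edges of $H$ (counted with multiplicity) containing both $x$ and $y$, and $\Delta_2(H)=\max_{\{x,y\}\subset X} d_H(\{x,y\})$. The line graph $L(H)$ is the graph whose vertices are the members of the family $E$, two distinct members $e,e'$ being adjacent iff $e\cap e'\neq\emptyset$. $L_k^{(p)}$ denotes the set of graphs that are (isomorphic to) line graphs $L(H)$ of $k$-uniform hypergraphs $H$ with $\Delta_2(H)\le p$. The degree of an edge $xy$ of a graph $G$ is the number of distinct triangles of $G$ containing that edge; the minimum edge-degree is the minimum of these over all edges of $G$ (so ''minimum edge-degree at least $m$'' means every edge lies in at least $m$ triangles). *)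

(* Defs.v *)
From HB Require Import structures.
From mathcomp Require Import all_boot all_order all_algebra.
From mathcomp Require Import mpoly.

Set Implicit Arguments.
Unset Strict Implicit.
Unset Printing Implicit Defensive.

Import GRing.Theory Num.Theory.

Record sgraph := SGraph {
  vertex :> finType;
  adj : rel vertex;
  adj_sym : ssrbool.symmetric adj;
  adj_irr : irreflexive adj }.

Definition isomorphic (G H : sgraph) : Prop :=
  exists f : G -> H, bijective f /\ forall x y : G, adj (f x) (f y) = adj x y.

Section Induced.
Variables (G : sgraph) (A : {set G}).

Definition induced_adj : rel {x : G | x \in A} :=
  fun u v => adj (val u) (val v).

Lemma induced_adj_sym : ssrbool.symmetric induced_adj.
Proof. by move=> u v; apply: adj_sym. Qed.

Lemma induced_adj_irr : irreflexive induced_adj.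
Proof. by move=> u; apply: adj_irr. Qed.

Definition induced : sgraph := SGraph induced_adj_sym induced_adj_irr.
End Induced.

Definition has_induced (G F : sgraph) : Prop :=
  exists A : {set G}, isomorphic (induced A) F.

Definition triangle (G : sgraph) (A : {set G}) : bool :=
  (#|A| == 3) && [forall x in A, forall y in A, (x != y) ==> adj x y].

Definition edge_degree (G : sgraph) (x y : G) : nat :=
  #|[set A : {set G} | triangle A & [set x; y] \subset A]|.

(* If [G] has no edge, the minimum is over the empty set and every bound [m]
   is met. *)
Definition min_edge_degree_ge (G : sgraph) (m : int) : Prop :=
  forall x y : G, adj x y -> (m <= (edge_degree x y)%:Z)%R.

(* The edges form a family indexed by [hedge], so an edge may be repeated. *)
Record hypergraph := Hypergraph {
  hvertex : finType;
  hedge : finType;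
  ends : hedge -> {set hvertex};
  ends_neq0 : forall e, ends e != set0 }.

Definition uniform (k : nat) (H : hypergraph) : Prop :=
  forall e : hedge H, #|ends e| = k.

Definition codegree (H : hypergraph) (x y : hvertex H) : nat :=
  #|[set e : hedge H | [set x; y] \subset ends e]|.

Definition Delta2 (H : hypergraph) : nat :=
  \max_(q : hvertex H * hvertex H | q.1 != q.2) codegree q.1 q.2.

Section LineGraph.
Variable H : hypergraph.

Definition line_adj : rel (hedge H) :=
  fun e e' => (e != e') && (ends e :&: ends e' != set0).

Lemma line_adj_sym : ssrbool.symmetric line_adj.
Proof. by move=> e e'; rewrite /line_adj eq_sym setIC. Qed.

Lemma line_adj_irr : irreflexive line_adj.
Proof. by move=> e; rewrite /line_adj eqxx. Qed.

Definition line_graph : sgraph := SGraph line_adj_sym line_adj_irr.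
End LineGraph.

(* The class L_k^(p). *)
Definition in_L (k p : nat) (G : sgraph) : Prop :=
  exists H : hypergraph,
    [/\ uniform k H, (Delta2 H <= p)%N & isomorphic G (line_graph H)].

Definition eval2 (f : {mpoly int[2]}) (k p : nat) : int :=
  (f.@[tnth [tuple k%:Z; p%:Z]])%R.

(* Main.v *)
Require Import Defs.
From mathcomp Require Import all_boot all_order all_algebra.
From mathcomp Require Import mpoly.
From Stdlib Require Import Classical.

Set Implicit Arguments.
Unset Strict Implicit.
Unset Printing Implicit Defensive.

Import GRing.Theory.

(** Write [G] as [L(H)] and attach to each vertex of [H] the clique of the
    edges through it.  Thus [G] is in [L_k^(p)] iff its edges are covered by
    cliques [K i] such that every vertex is in at most [k] of them and two of
    them share at most [p] vertices.  In such a cover, a clique with more than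
    [k^2 p] vertices lies in a single [K i], and an edge in more than
    [k^3 p + k^2 p] triangles lies in a [K i] with more than [k^2 p] vertices.
    Hence, when all the edges are in that many triangles, the only candidate
    cover consists of the maximal cliques with more than [k^2 p] vertices, and
    each way in which it can fail to be a cover is witnessed by an induced
    subgraph of bounded order that is not in [L_k^(p)].  The forbidden graphs
    are all the graphs of at most that order outside [L_k^(p)]. *)

(** * Counting in finite sets *)

Lemma exists_subset_card (T : finType) (A : {set T}) (m : nat) :
  m <= #|A| -> exists2 B : {set T}, B \subset A & #|B| = m.
Proof.
move=> leA; exists [set x in take m (enum A)].
  by apply/subsetP=> x; rewrite inE => /mem_take; rewrite mem_enum.
rewrite cardsE (card_uniqP _) ?take_uniq ?enum_uniq // size_takel //.
by rewrite -cardE.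
Qed.

Lemma card_bigcup_leq (T J : finType) (P : {set J}) (F : J -> {set T}) :
  #|\bigcup_(j in P) F j| <= \sum_(j in P) #|F j|.
Proof.
elim/big_rec2: _ => [|j m A _ leA]; first by rewrite cards0.
by rewrite (leq_trans (leq_card_setU _ _)) // leq_add2l.
Qed.

Lemma card_bigcup_le (T J : finType) (P : {set J}) (F : J -> {set T}) (m : nat) :
  (forall j, j \in P -> #|F j| <= m) -> #|\bigcup_(j in P) F j| <= #|P| * m.
Proof.
move=> leF; rewrite -sum_nat_const.
by apply: (leq_trans (card_bigcup_leq _ _)); apply: leq_sum.
Qed.

Lemma card_ord_lt (k m : nat) : m <= k -> #|[set j : 'I_k | j < m]| = m.
Proof.
move=> le_mk; rewrite -sum1dep_card -(big_ord_widen k (fun=> 1) le_mk).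
by rewrite sum1_card card_ord.
Qed.

(** * Cliques and triangles of a graph *)

Section Cliques.
Variable G : sgraph.
Implicit Types (x y : G) (A B C D S W : {set G}).

Definition clique A : bool :=
  [forall x in A, forall y in A, (x != y) ==> adj x y].

Lemma cliqueP A :
  reflect {in A &, forall x y, x != y -> adj x y} (clique A).
Proof.
apply: (iffP forall_inP) => [cA x y xA yA|cA x xA].
  by move/forall_inP/(_ y yA)/implyP: (cA x xA).
by apply/forall_inP=> y yA; apply/implyP; apply: cA.
Qed.

Lemma cliqueS A B : A \subset B -> clique B -> clique A.
Proof.
move=> /subsetP sAB /cliqueP cB; apply/cliqueP=> x y /sAB xB /sAB yB.
exact: cB.
Qed.

(** Otherwise [A :|: B] would be a clique, and maximality would make both sets equal to it. *)
Lemma max_cliques_nonadjacent A B :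
  maxset clique A -> maxset clique B -> A != B ->
  exists a b, [/\ a \in A, b \in B, a != b & ~~ adj a b].
Proof.
move=> mA mB neAB; apply: NNPP => noab.
suff cU : clique (A :|: B).
  case/eqP: neAB; rewrite -(maxsetsup mA cU (subsetUl _ _)).
  by rewrite -[in RHS](maxsetsup mB cU (subsetUr _ _)).
have /cliqueP cA := maxsetp mA; have /cliqueP cB := maxsetp mB.
have cAB a b : a \in A -> b \in B -> a != b -> adj a b.
  by move=> aA bB ab; apply/idPn=> nab; apply: noab; exists a, b.
apply/cliqueP=> x y /setUP[xA|xB] /setUP[yA|yB] xy; first exact: cA.
- exact: cAB.
- by rewrite adj_sym cAB // eq_sym.
- exact: cB.
Qed.

Definition common_neighbours x y : {set G} := [set z | adj x z & adj y z].

(** A triangle on the edge is determined by its third vertex, which is a common neighbour of the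
    ends. *)
Lemma edge_degree_le_common x y :
  adj x y -> edge_degree x y <= #|common_neighbours x y|.
Proof.
move=> adj_xy.
have xy : x != y by apply: contraTneq adj_xy => ->; rewrite adj_irr.
apply: leq_trans (leq_imset_card (fun z => z |: [set x; y]) _).
apply: subset_leq_card; apply/subsetP=> A.
rewrite inE => /andP[/andP[/eqP cardA /cliqueP cA] sxyA].
have /cards1P[z defAz] : #|A :\: [set x; y]| == 1.
  by rewrite cardsD (setIidPr sxyA) cards2 xy cardA.
have /setDP[zA] : z \in A :\: [set x; y] by rewrite defAz set11.
rewrite !inE negb_or => /andP[zx zy].
apply/imsetP; exists z; last first.
  by rewrite -defAz setUC -{1}(setIidPr sxyA) setID.
by rewrite inE !cA // ?(subsetP sxyA) ?set21 ?set22 // eq_sym.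
Qed.

End Cliques.

Arguments clique {G} A.

(** * Covers by cliques of bounded degree and codegree *)

Section Covers.
Variables (G : sgraph) (k p : nat).

(** [K i] stands for the set of hyperedges through the hypergraph vertex [i]. The degree is only
    bounded by [k]; uniformity is restored later by padding. *)
Record clique_cover (S : {set G}) (I : finType) (K : I -> {set G}) : Prop :=
  CliqueCover {
    cover_sub : forall i, K i \subset S;
    cover_adj : {in S &, forall x y, x != y ->
                   adj x y = [exists i, (x \in K i) && (y \in K i)]};
    cover_deg : {in S, forall x, #|[set i | x \in K i]| <= k};
    cover_codeg : forall i j, i != j -> #|K i :&: K j| <= p }.

Definition coverable (S : {set G}) : Prop :=
  exists (I : finType) (K : I -> {set G}), clique_cover S K.

Section FixedCover.
Variables (S : {set G}) (I : finType) (K : I -> {set G}).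
Hypothesis coverK : clique_cover S K.

Lemma cover_clique i : clique (K i).
Proof.
have /subsetP sKS := cover_sub coverK i.
apply/cliqueP=> x y xK yK xy; rewrite (cover_adj coverK) ?sKS //.
by apply/existsP; exists i; rewrite xK.
Qed.

Lemma cover_adjP x y : x \in S -> y \in S -> x != y -> adj x y ->
  exists2 i, x \in K i & y \in K i.
Proof.
move=> xS yS xy; rewrite (cover_adj coverK) // => /existsP[i /andP[xi yi]].
by exists i.
Qed.

(** Pigeonhole twice. The at most [k] members through a vertex [x] of [C] cover [C], so one of them,
    [K i], has more than [k * p] vertices of [C]. A vertex of [C] outside [K i] would reach all of
    these through at most [k] other members, each sharing at most [p] vertices with [K i]. *)
Lemma big_clique_in_cover (C : {set G}) :
  C \subset S -> clique C -> 1 < #|C| -> k ^ 2 * p < #|C| ->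
  exists i, C \subset K i.
Proof.
move=> sCS /cliqueP cC C_gt1 C_big.
have /card_gt1P[x [x' [xC x'C xx']]] := C_gt1.
have inS := subsetP sCS.
have [i xi Ki_big] : exists2 i, x \in K i & k * p < #|C :&: K i|.
  apply: NNPP => no_i; move: C_big; apply/negP; rewrite -leqNgt.
  have sC : C \subset \bigcup_(i in [set i | x \in K i]) (C :&: K i).
    apply/subsetP=> y yC; apply/bigcupP.
    (* The vertex [x] itself is covered through its edge to [x']. *)
    have [z [zC xz yz]] : exists z, [/\ z \in C, x != z & (y == x) || (y == z)].
      have [->|yx] := eqVneq y x; first by exists x'.
      by exists y; rewrite eq_sym yx eqxx.
    have [i xi zi] := cover_adjP (inS _ xC) (inS _ zC) xz (cC _ _ xC zC xz).
    by exists i; rewrite inE // yC; case/pred2P: yz => ->.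
  apply: leq_trans (subset_leq_card sC) _.
  apply: leq_trans (card_bigcup_le (m := k * p) _) _ => [i|].
    by rewrite inE => xi; rewrite leqNgt; apply/negP=> lt_i; apply: no_i; exists i.
  by rewrite -mulnn -mulnA leq_mul2r (cover_deg coverK) ?orbT ?inS.
exists i; apply/subsetP=> y yC; apply: contraLR Ki_big => yNi.
rewrite -leqNgt.
have sK : C :&: K i \subset
    \bigcup_(j in [set j | y \in K j]) (K i :&: K j).
  apply/subsetP=> z /setIP[zC zi]; apply/bigcupP.
  have yz : y != z by apply: contraNneq yNi => ->.
  have [j yj zj] := cover_adjP (inS _ yC) (inS _ zC) yz (cC _ _ yC zC yz).
  by exists j; rewrite inE // zi.
apply: leq_trans (subset_leq_card sK) _.
apply: leq_trans (card_bigcup_le (m := p) _) _ => [j|].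
  rewrite inE => yj; apply: (cover_codeg coverK).
  by apply: contraNneq yNi => ->.
by rewrite leq_mul2r (cover_deg coverK) ?orbT ?inS.
Qed.

(** Each vertex of [W] lies in some [K i :&: K j] with [x] in [K i] and [y] in [K j]. The pairs
    [i != j] account for at most [k ^ 2 * p] vertices and, if no member through both ends is big,
    the pairs [i = j] for at most [k * (k ^ 2 * p)]. *)
Lemma heavy_edge_in_big_cover x y (W : {set G}) :
  x \in S -> y \in S -> W \subset S -> W \subset common_neighbours x y ->
  k ^ 3 * p + k ^ 2 * p < #|W| ->
  exists i, [/\ x \in K i, y \in K i & k ^ 2 * p < #|K i|].
Proof.
move=> xS yS /subsetP sWS /subsetP sWN W_big; apply: NNPP => no_i.
move: W_big; apply/negP; rewrite -leqNgt.
have sW : W \subset \bigcup_(i in [set i | x \in K i])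
    \bigcup_(j in [set j | y \in K j]) (K i :&: K j).
  apply/subsetP=> z zW; have := sWN _ zW; rewrite inE => /andP[xz yz].
  have xNz : x != z by apply: contraTneq xz => ->; rewrite adj_irr.
  have yNz : y != z by apply: contraTneq yz => ->; rewrite adj_irr.
  have [i xi zi] := cover_adjP xS (sWS _ zW) xNz xz.
  have [j yj zj] := cover_adjP yS (sWS _ zW) yNz yz.
  apply/bigcupP; exists i; first by rewrite inE.
  by apply/bigcupP; exists j; rewrite inE // zi.
apply: leq_trans (subset_leq_card sW) _.
apply: leq_trans (card_bigcup_le (m := k ^ 2 * p + k * p) _) _ => [i|]; last first.
  have -> : k ^ 3 * p + k ^ 2 * p = k * (k ^ 2 * p + k * p).
    by rewrite mulnDr (mulnA k k) (mulnA k (k ^ 2)) -expnS mulnn.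
  by rewrite leq_mul2r (cover_deg coverK) ?orbT.
rewrite inE => xi; apply: leq_trans (card_bigcup_leq _ _) _.
apply: (@leq_trans (\sum_(j in [set j | y \in K j])
          ((j == i) * (k ^ 2 * p) + p))).
  apply: leq_sum => j; rewrite inE => yj.
  have [eji|ji] := eqVneq j i; last by rewrite (cover_codeg coverK) // eq_sym.
  rewrite eji setIid mul1n (leq_trans _ (leq_addr _ _)) // leqNgt.
  by apply/negP=> Ki_big; apply: no_i; exists i; rewrite xi -{1}eji yj.
rewrite big_split /= sum_nat_const; apply: leq_add; last first.
  by rewrite leq_mul2r (cover_deg coverK) ?orbT.
rewrite -big_distrl /= -[leqRHS]mul1n leq_mul2r; apply/orP; right.
have [yi|yNi] := boolP (i \in [set j | y \in K j]).
  by rewrite (bigD1 i) //= eqxx big1 // => j /andP[_ /negPf->].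
by rewrite big1 // => j yj; case: eqVneq => // eji; rewrite -eji yj in yNi.
Qed.

End FixedCover.
End Covers.

(** * Line graphs and clique covers *)

(** The stars of the hypergraph vertices, pulled back along [e], form the cover. A general [e]
    serves both for an isomorphism from [induced S] and for the embedding of a forbidden graph. *)
Lemma in_L_coverable (F G : sgraph) (k p : nat) (S : {set G}) (e : G -> F) :
  {in S &, injective e} -> {in S &, forall x y, adj (e x) (e y) = adj x y} ->
  in_L k p F -> coverable k p S.
Proof.
move=> inj_e adj_e [H [uH dH [phi [bij_phi adj_phi]]]].
have inj_phi := bij_inj bij_phi.
exists (hvertex H), (fun v => [set x in S | v \in ends (phi (e x))]); split.
- by move=> v; apply/subsetP=> x; rewrite inE => /andP[].
- move=> x y xS yS xy; rewrite -adj_e // -adj_phi /= /line_adj.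
  rewrite inj_eq // (inj_in_eq inj_e) // xy /=.
  apply/set0Pn/existsP=> [[v /setIP[vx vy]]|[v]].
    by exists v; rewrite !inE xS yS vx vy.
  by rewrite !inE xS yS /= => /andP[vx vy]; exists v; rewrite inE vx vy.
- move=> x xS; rewrite -(uH (phi (e x))); apply: subset_leq_card.
  by apply/subsetP=> v; rewrite !inE => /andP[].
move=> u v uv; apply: leq_trans dH.
apply: leq_trans (leq_bigmax_cond (u, v) uv); rewrite /codegree /=.
rewrite -(card_in_imset (f := phi \o e)); last first.
  move=> x y /setIP[]; rewrite inE => /andP[xS _] _ /setIP[].
  by rewrite inE => /andP[yS _] _ /inj_phi/inj_e->.
apply: subset_leq_card; apply/subsetP=> _ /imsetP[x + ->].
by rewrite !inE subUset !sub1set => /andP[/andP[_ ->] /andP[_ ->]].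
Qed.

Lemma in_L_induced (F G : sgraph) (k p : nat) (S : {set G}) :
  isomorphic (induced S) F -> in_L k p F -> coverable k p S.
Proof.
move=> [g [bij_g adj_g]] FL.
(* The map on all of [G] needs a default vertex [x0] of [S], so empty [S] is treated apart. *)
have [->|[x0 x0S]] := set_0Vmem S.
  exists void, (fun=> set0); split; try by case.
  - by move=> x y; rewrite inE.
  - by move=> x; rewrite inE.
apply: (in_L_coverable (e := fun x => g (insubd (exist _ x0 x0S) x))) FL.
  move=> x y xS yS /(bij_inj bij_g)/(congr1 val).
  by rewrite !val_insubd xS yS.
by move=> x y xS yS; rewrite adj_g /= /induced_adj !val_insubd xS yS.
Qed.

(** Dual hypergraph: the edge of [x] is the set of indices of the members containing [x], padded to
    size [k]. *)
Lemma coverable_in_L (G : sgraph) (k p : nat) :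
  0 < k -> 0 < p -> coverable k p [set: G] -> in_L k p G.
Proof.
move=> k_gt0 p_gt0 [I [K coverK]].
pose d x := #|[set i | x \in K i]|.
have d_le x : d x <= k by rewrite (cover_deg coverK) ?inE.
pose clique_ends x : {set I + G * 'I_k} := inl @: [set i | x \in K i].
(* New vertices of degree one bring every edge up to size [k]. *)
pose pendant_ends x : {set I + G * 'I_k} :=
  (fun j => inr (x, j)) @: [set j : 'I_k | j < k - d x].
pose E x := clique_ends x :|: pendant_ends x.
have inlE x i : (inl i \in E x) = (x \in K i).
  rewrite inE mem_imset ?inE; last by move=> ? ? [].
  by case: imsetP => [[//]|_]; rewrite orbF.
have inrE x w j : inr (w, j) \in E x -> w = x.
  by rewrite inE => /orP[]/imsetP[? _] // [->].
have cardE x : #|E x| = k.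
  rewrite cardsU disjoint_setI0 ?cards0 ?subn0; last first.
    apply/pred0P=> u /=; apply/negP=> /andP[/imsetP[i _ ->]].
    by case/imsetP.
  have inj_inl : injective (@inl I (G * 'I_k)) by move=> ? ? [].
  have inj_inr : injective (fun j => @inr I (G * 'I_k) (x, j)) by move=> ? ? [].
  by rewrite !card_imset // card_ord_lt ?leq_subr // -/(d x) subnKC.
have E_neq0 x : E x != set0 by rewrite -card_gt0 cardE.
exists (Hypergraph E_neq0); split=> //.
  apply/bigmax_leqP=> -[u v] /= uv; rewrite /codegree /=.
  (* The vertex [inr (w, j)] can only lie in the edge of [w], so its pairs have codegree at most
     1. *)
  have pendant w j (U : {set G}) :
      {in U, forall x, inr (w, j) \in E x} -> #|U| <= p.
    move=> sU; apply: leq_trans p_gt0; rewrite -(cards1 w) subset_leq_card //.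
    by apply/subsetP=> x /sU/inrE->; rewrite inE.
  case: u v uv => [i|[w j]] [i'|[w' j']] uv.
  - apply: leq_trans (cover_codeg coverK uv); apply: subset_leq_card.
    by apply/subsetP=> x; rewrite !inE subUset !sub1set !inlE.
  - by apply: (pendant w' j') => x; rewrite inE subUset !sub1set => /andP[].
  - by apply: (pendant w j) => x; rewrite inE subUset !sub1set => /andP[].
  - by apply: (pendant w j) => x; rewrite inE subUset !sub1set => /andP[].
exists id; split=> [|x y /=]; first by exists id.
rewrite /line_adj /=; have [->|xy] := eqVneq x y; first by rewrite adj_irr.
rewrite (cover_adj coverK) ?inE //=.
apply/set0Pn/existsP=> [[[i|[w j]]]|[i /andP[xi yi]]].
- by rewrite inE !inlE; exists i.
- by rewrite inE => /andP[/inrE wx /inrE wy]; rewrite -wx wy eqxx in xy.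
- by exists (inl i); rewrite inE !inlE xi.
Qed.

(** * From local covers to a global cover *)

(** Room for [d] prescribed vertices and, for each of [q] big cliques, [k ^ 2 * p + 1] of its
    vertices and a nonadjacent pair against each of the [q] cliques. *)
Definition witness_bound (k p q d : nat) := d + q * ((k ^ 2 * p).+1 + q * 2).

(** The summands serve three failures: a heavy edge in no big clique, two big cliques sharing
    [p + 1] vertices, and [k + 1] big cliques through one vertex. *)
Definition order_bound (k p : nat) :=
  (k ^ 3 * p + k ^ 2 * p).+3 + witness_bound k p 2 p.+1
  + witness_bound k p k.+1 1.

Section LocalToGlobal.
Variables (G : sgraph) (k p N : nat).
Hypotheses (k_gt0 : 0 < k) (p_gt0 : 0 < p).
Hypothesis local_cover : forall S : {set G}, #|S| <= N -> coverable k p S.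
Implicit Types (A B C D S : {set G}) (Q : {set {set G}}).

Definition big_cliques : {set {set G}} :=
  [set A : {set G} | maxset clique A & k ^ 2 * p < #|A|].

Lemma big_clique_sub_cover S (I : finType) (K : I -> {set G}) C :
  clique_cover k p S K -> C \subset S -> clique C -> k ^ 2 * p < #|C| ->
  exists i, C \subset K i.
Proof.
move=> coverK sCS cC C_big; apply: (big_clique_in_cover coverK) => //.
by apply: leq_ltn_trans C_big; rewrite muln_gt0 expn_gt0 k_gt0.
Qed.

(** [S] collects enough vertices of each clique to keep it big, and a nonadjacent pair for every two
    distinct cliques to keep them apart. *)
Lemma big_cliques_witness Q :
  Q \subset big_cliques ->
  exists S, [/\ #|S| <= #|Q| * ((k ^ 2 * p).+1 + #|Q| * 2),
    {in Q, forall A, k ^ 2 * p < #|A :&: S|}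
  & {in Q &, forall A B, A != B ->
      exists a b, [/\ a \in A :&: S, b \in B :&: S, a != b & ~~ adj a b]}].
Proof.
move=> /subsetP sQ.
have /fin_all_exists[T T_P] (AB : {set G} * {set G}) : exists T : {set G},
    #|T| <= 2 /\ (AB.1 \in Q -> AB.2 \in Q -> AB.1 != AB.2 ->
      exists a b, [/\ a \in AB.1 :&: T, b \in AB.2 :&: T, a != b & ~~ adj a b]).
  case: AB => A B /=.
  have [[AQ BQ nAB]|nAB] := classic [/\ A \in Q, B \in Q & A != B]; last first.
    by exists set0; rewrite cards0; split=> // AQ BQ AB; case: nAB.
  have := sQ _ AQ; have := sQ _ BQ; rewrite !inE => /andP[mB _] /andP[mA _].
  have [a [b [aA bB ab nab]]] := max_cliques_nonadjacent mA mB nAB.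
  exists [set a; b]; rewrite cards2; split; first by case: eqVneq.
  by move=> _ _ _; exists a, b; rewrite !inE !eqxx orbT aA bB.
have /fin_all_exists[C C_P] A : exists C : {set G},
    #|C| <= (k ^ 2 * p).+1 /\ (A \in Q -> k ^ 2 * p < #|A :&: C|).
  have [AQ|_] := boolP (A \in Q); last by exists set0; rewrite cards0.
  have := sQ _ AQ; rewrite inE => /andP[_ /exists_subset_card[C sCA cC]].
  by exists C; rewrite (setIidPr sCA) cC.
pose R A := C A :|: \bigcup_(B in Q) T (A, B).
have sRS A : A \in Q -> R A \subset \bigcup_(A in Q) R A.
  exact: bigcup_sup.
have sTS A B : A \in Q -> B \in Q -> T (A, B) \subset \bigcup_(A in Q) R A.
  move=> AQ BQ; apply: subset_trans (sRS _ AQ).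
  by apply: subset_trans (subsetUr _ _); apply: (bigcup_sup B).
exists (\bigcup_(A in Q) R A); split.
- apply: card_bigcup_le => A AQ; apply: leq_trans (leq_card_setU _ _) _.
  apply: leq_add; first by case: (C_P A).
  by apply: card_bigcup_le => B BQ; case: (T_P (A, B)).
- move=> A AQ; case: (C_P A) => _ /(_ AQ)/leq_trans; apply.
  apply/subset_leq_card/setIS; apply: subset_trans (sRS _ AQ).
  exact: subsetUl.
- move=> A B AQ BQ AB; case: (T_P (A, B)) => _ /= /(_ AQ BQ AB)[a [b]].
  rewrite !inE => -[/andP[aA aT] /andP[bB bT] ab nab]; exists a, b.
  by rewrite !inE aA bB !(subsetP (sTS A B AQ BQ)).
Qed.

(* Distinct big maximal cliques lie in distinct members of a suitable local
   cover, which transfers its bounds to them. *)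
Lemma big_cliques_local_cover Q D :
  Q \subset big_cliques -> {in Q, forall A, D \subset A} ->
  witness_bound k p #|Q| #|D| <= N -> Q != set0 ->
  exists S (I : finType) (K : I -> {set G}) (phi : {set G} -> I),
    [/\ clique_cover k p S K, D \subset S, {in Q &, injective phi}
      & {in Q, forall A, D \subset K (phi A)}].
Proof.
move=> sQ sDQ leN /set0Pn[A0 A0Q].
have [S0 [cardS0 bigS0 sepS0]] := big_cliques_witness sQ.
pose S := D :|: S0.
have [I [K coverK]] : coverable k p S.
  apply: local_cover; apply: leq_trans leN.
  by apply: leq_trans (leq_card_setU _ _) _; rewrite leq_add2l.
have sKA A : A \in Q -> exists i, A :&: S \subset K i.
  move=> AQ; have := subsetP sQ _ AQ; rewrite inE => /andP[/maxsetp cA _].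
  apply: (big_clique_sub_cover coverK); first exact: subsetIr.
    exact: cliqueS (subsetIl _ _) cA.
  apply: leq_trans (bigS0 _ AQ) _.
  by apply/subset_leq_card/setIS/subsetUr.
(* Default value of [phi] outside [Q], available because [Q] is nonempty. *)
have [i0 _] := sKA _ A0Q.
have /fin_all_exists[phi phiP] A : exists i, A \in Q -> A :&: S \subset K i.
  have [/sKA[i]|_] := boolP (A \in Q); last by exists i0.
  by exists i.
exists S, I, K, phi; split=> //; first exact: subsetUl.
  (* With equal images, the nonadjacent [a] and [b] would lie in one clique [K (phi A)]. *)
  move=> A B AQ BQ eq_phi; apply/eqP/idPn=> AB.
  have [a [b [/setIP[aA aS] /setIP[bB bS] ab /negP[]]]] := sepS0 A B AQ BQ AB.
  have /cliqueP cK := cover_clique coverK (phi A); apply: cK => //.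
    by apply: (subsetP (phiP A AQ)); rewrite !inE aA aS orbT.
  by rewrite eq_phi; apply: (subsetP (phiP B BQ)); rewrite !inE bB bS orbT.
move=> A AQ; apply: subset_trans (phiP A AQ).
by rewrite subsetI sDQ // subsetUl.
Qed.

(** Otherwise [p + 1] common vertices would lie in two distinct members of a local cover. *)
Lemma big_cliques_codegree A B :
  witness_bound k p 2 p.+1 <= N ->
  A \in big_cliques -> B \in big_cliques -> A != B -> #|A :&: B| <= p.
Proof.
move=> leN bA bB AB; rewrite leqNgt; apply/negP=> /exists_subset_card[D].
rewrite subsetI => /andP[sDA sDB] cardD.
have [||||S [I [K [phi [coverK _ inj_phi sDK]]]]] :=
    @big_cliques_local_cover [set A; B] D.
- by rewrite subUset !sub1set bA.
- by move=> C /set2P[]->.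
- by rewrite cards2 AB cardD.
- by apply/set0Pn; exists A; rewrite set21.
have neq_phi : phi A != phi B by rewrite (inj_in_eq inj_phi) ?set21 ?set22.
have := cover_codeg coverK neq_phi; rewrite leqNgt => /negP; apply.
rewrite -cardD; apply: subset_leq_card.
by rewrite subsetI !sDK ?set21 ?set22.
Qed.

(** Otherwise [k + 1] of them would give [k + 1] members of a local cover through [x]. *)
Lemma big_cliques_degree x :
  witness_bound k p k.+1 1 <= N -> #|[set A in big_cliques | x \in A]| <= k.
Proof.
move=> leN; rewrite leqNgt; apply/negP=> /exists_subset_card[Q].
move=> /subsetP sQ cardQ.
have [||||S [I [K [phi [coverK xS inj_phi sxK]]]]] :=
    @big_cliques_local_cover Q [set x].
- by apply/subsetP=> A /sQ; rewrite !inE => /andP[].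
- by move=> A /sQ; rewrite inE sub1set => /andP[].
- by rewrite cardQ cards1.
- by rewrite -card_gt0 cardQ.
rewrite sub1set in xS.
have := cover_deg coverK xS; rewrite leqNgt => /negP; apply.
rewrite -cardQ -(card_in_imset inj_phi); apply: subset_leq_card.
by apply/subsetP=> _ /imsetP[A AQ ->]; rewrite inE -sub1set sxK.
Qed.

(** Cover the edge together with [k ^ 3 * p + k ^ 2 * p + 1] common neighbours, then extend the big
    member through it to a maximal clique of [G]. *)
Lemma heavy_edge_in_big_clique x y :
  k ^ 3 * p + k ^ 2 * p < #|common_neighbours x y| ->
  (k ^ 3 * p + k ^ 2 * p).+3 <= N ->
  exists A, [/\ A \in big_cliques, x \in A & y \in A].
Proof.
move=> /exists_subset_card[W sWN cardW] leN.
pose S := [set x; y] :|: W.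
have [I [K coverK]] : coverable k p S.
  apply: local_cover; apply: leq_trans leN.
  apply: leq_trans (leq_card_setU _ _) _; rewrite cardW cards2.
  by case: (x != y).
have [||||i [xi yi Ki_big]] :=
    heavy_edge_in_big_cover coverK (x := x) (y := y) _ _ _ sWN.
- by rewrite !inE eqxx.
- by rewrite !inE eqxx orbT.
- exact: subsetUr.
- by rewrite cardW.
have [A mA sKA] := maxset_exists (cover_clique coverK i).
exists A; rewrite inE mA !(subsetP sKA) //; split=> //.
exact: leq_trans Ki_big (subset_leq_card sKA).
Qed.

Lemma coverable_setT :
  order_bound k p <= N ->
  (forall x y : G, adj x y ->
     k ^ 3 * p + k ^ 2 * p < #|common_neighbours x y|) ->
  coverable k p [set: G].
Proof.
rewrite /order_bound => leN heavy.
have leN1 := leq_trans (leq_addr _ _) leN.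
have leN2 := leq_trans (leq_addl _ _) leN.
(* All vertex sets serve as indices; those that are not big maximal cliques contribute the empty
   set. *)
exists {set G}, (fun A => if A \in big_cliques then A else set0); split.
- by move=> A; apply: subsetT.
- move=> x y _ _ xy; apply/idP/existsP=> [adj_xy|[A]].
    have [A [bA xA yA]] := heavy_edge_in_big_clique (heavy _ _ adj_xy)
      (leq_trans (leq_addr _ _) leN1).
    by exists A; rewrite bA xA.
  case: ifP => [|_]; last by rewrite in_set0.
  rewrite inE => /andP[/maxsetp/cliqueP cA _] /andP[xA yA].
  exact: cA.
- move=> x _; apply: leq_trans (big_cliques_degree x leN2).
  apply: subset_leq_card; apply/subsetP=> A; rewrite inE.
  by case: ifP => [bA xA|_]; [apply/setIdP | rewrite in_set0].
move=> A B AB; case: ifP => [bA|_]; last by rewrite set0I cards0.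
case: ifP => [bB|_]; last by rewrite setI0 cards0.
exact: big_cliques_codegree (leq_trans (leq_addl _ _) leN1) bA bB AB.
Qed.

End LocalToGlobal.

(** * The finite family of forbidden graphs *)

Section CodedGraphs.
Variables (m : nat) (r : {set 'I_m * 'I_m}).

(** Symmetrising and removing loops lets every set [r] code a graph, so the codes of bounded order
    form a finite type. *)
Definition coded_adj : rel 'I_m :=
  fun i j => (i != j) && (((i, j) \in r) || ((j, i) \in r)).

Lemma coded_adj_sym : ssrbool.symmetric coded_adj.
Proof. by move=> i j; rewrite /coded_adj eq_sym orbC. Qed.

Lemma coded_adj_irr : irreflexive coded_adj.
Proof. by move=> i; rewrite /coded_adj eqxx. Qed.

Definition coded_graph : sgraph := SGraph coded_adj_sym coded_adj_irr.
End CodedGraphs.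

Lemma isomorphic_coded (G : sgraph) :
  exists r : {set 'I_#|G| * 'I_#|G|}, isomorphic G (coded_graph r).
Proof.
exists [set ij | adj (enum_val ij.1) (enum_val ij.2)], enum_rank; split.
  by exists enum_val; [apply: enum_rankK | apply: enum_valK].
move=> x y /=; rewrite /coded_adj !inE /= !enum_rankK adj_sym orbb.
rewrite (inj_eq enum_rank_inj); case: eqVneq => // ->.
by rewrite adj_irr.
Qed.

Lemma finite_set_of_prop (T : finType) (P : T -> Prop) :
  exists A : {set T}, forall t, t \in A <-> P t.
Proof.
have /fin_all_exists[b bP] t : exists b : bool, b <-> P t.
  by have [Pt|nPt] := classic (P t); [exists true | exists false].
by exists [set t | b t] => t; rewrite inE.
Qed.

(** The family lists the coded graphs of order at most [N] outside the class; an uncoverable [S]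
    induces one of them. *)
Lemma finite_forbidden_family (k p N : nat) :
  exists (n : nat) (F : 'I_n -> sgraph),
    (forall i, ~ in_L k p (F i)) /\
    forall (G : sgraph) (S : {set G}), #|S| <= N -> ~ coverable k p S ->
      exists i, isomorphic (induced S) (F i).
Proof.
pose code := {m : 'I_N.+1 & {set 'I_m * 'I_m}}.
pose graph (t : code) := coded_graph (tagged t).
have [B B_P] := finite_set_of_prop (fun t => ~ in_L k p (graph t)).
exists #|B|, (fun i => graph (enum_val i)); split=> [i|G S cardS nS].
  by apply/B_P/enum_valP.
have [r iso_r] := isomorphic_coded (induced S).
have ltN : #|induced S| < N.+1 by rewrite ltnS card_sig.
pose t : code := @Tagged _ (Ordinal ltN) (fun m : 'I_N.+1 => {set 'I_m * 'I_m}) r.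
have tB : t \in B by apply/B_P=> tL; apply: nS; apply: in_L_induced tL.
by exists (enum_rank_in tB t); rewrite enum_rankK_in.
Qed.

(** * The polynomial and the characterisation *)

(** The final 1 turns the bound on the edge-degree into the strict inequality needed for heavy
    edges. *)
Definition edge_degree_poly : {mpoly int[2]} :=
  ('X_[U_(ord0) *+ 3 + U_(ord_max)] + 'X_[U_(ord0) *+ 2 + U_(ord_max)] + 1)%R.

Lemma eval2_edge_degree_poly k p :
  eval2 edge_degree_poly k p = Posz (k ^ 3 * p + k ^ 2 * p).+1.
Proof.
rewrite /eval2 !mevalD meval1 !mevalX !big_ord_recl !big_ord0.
rewrite !mnmDE !mnm1E /= !(tnth_nth 0%R) /=.
by rewrite !addn0 !mulr1 -(addn1 (_ + _)) -[RHS]natz !natrD !natrM !natz.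
Qed.

Lemma msize_edge_degree_poly : msize edge_degree_poly <= 5.
Proof.
apply: leq_trans (msizeD_le _ _) _; rewrite msize1 geq_max andbT.
apply: leq_trans (msizeD_le _ _) _.
by rewrite !msizeX !mdegD !mdeg1.
Qed.

(* [msize f] is one more than the total degree of a nonzero [f]. *)
Theorem theorem1p1 :
  exists f : {mpoly int[2]}, (msize f <= 5)%N /\
    forall k p : nat, (2 <= k)%N -> (1 <= p)%N ->
      exists (n : nat) (F : 'I_n -> sgraph),
        forall G : sgraph, min_edge_degree_ge G (eval2 f k p) ->
          (in_L k p G <-> ~ exists i : 'I_n, has_induced G (F i)).
Proof.
exists edge_degree_poly; split=> [|k p k_gt1 p_gt0].
  exact: msize_edge_degree_poly.
have k_gt0 := ltnW k_gt1.
have [n [F [FnL F_P]]] := finite_forbidden_family k p (order_bound k p).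
exists n, F => G; rewrite eval2_edge_degree_poly => deg_ge; split.
  (* A cover of [G] restricts to the copy of [F i], embedded by the inverse [h], and would put [F i]
     in the class. *)
  move=> GL [i [A [g [[h gK hK] adj_g]]]]; apply: (FnL i).
  apply: (coverable_in_L k_gt0 p_gt0).
  apply: (in_L_coverable (e := fun x => val (h x))) GL.
    by move=> x y _ _ /val_inj/(can_inj hK).
  by move=> x y _ _; rewrite -[in RHS](hK x) -[in RHS](hK y) adj_g.
move=> noF; apply: (coverable_in_L k_gt0 p_gt0).
apply: (coverable_setT (N := order_bound k p)) => // [S cardS|x y adj_xy].
  apply: NNPP => /(F_P _ _ cardS)[i iso_i].
  by apply: noF; exists i, S.
exact: leq_trans (deg_ge _ _ adj_xy) (edge_degree_le_common adj_xy).
Qed.
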